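(* Let $J\in\mathbb T$. If $f\in\mathcal S_T^1(\Omega_D,A)$, then $(\overline\partial_Tf)_J=\overline\partial_Jf_J$ and $(\partial_Tf)_J=\partial_Jf_J$. If moreover $f\in\mathcal S_T^2(\Omega_D,A)$, then $(\Delta_Tf)_J=\Delta_Jf_J$. Here $g_J$ denotes the restriction of $g$ to $(\Omega_D)_J=\Omega_D\cap\mathbb R_J$.
   Context: $A$ is a finite-dimensional associative real algebra with unit and a $*$-involution $x\mapsto x^c$; $\mathbb S_A=\{x:x+x^c=0,xx^c=1\}\ne\emptyset$. $V\subseteq A$ has basis $(v_0=1,v_1,\dots,v_N)$, $N\ge1$, $v_s\in\mathbb S_A$ pairwise anticommuting for $s\ge1$, $V\subseteq\bigcup_{J\in\mathbb S_A}(\mathbb R+J\mathbb R)$, and $A$ carries the Euclidean norm making a completion of this basis orthonormal. $\mathbb R_{\ell,m}=\mathrm{Span}_{\mathbb R}(v_\ell,\dots,v_m)$, $\mathbb S_{\ell,m}$ its unit sphere. $T=(t_0,\dots,t_\tau)$, $0\le t_0<\dots<t_\tau=N$, torus $\mathbb T=\mathbb S_{t_0+1,t_1}\times\cdots\times\mathbb S_{t_{\tau-1}+1,t_\tau}$ (for $\tau=0$, single index $J=\emptyset$). For $J\in\mathbb T$, $\beta\in\mathbb R^\tau$: $\beta J=\sum\beta_hJ_h$; $J_\emptyset=1$, $J_K=J_{k_1}\cdots J_{k_p}$ for $K=\{k_1<\dots<k_p\}$; $\overline\beta^h$ flips the sign of $\beta_h$; $\sigma(h,K)$ is the parity of $\#\{k\in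 K:k\le h\}$. $D\subseteq\mathbb R_{0,t_0}\times\mathbb R^\tau$ open, invariant under $(\alpha,\beta)\mapsto(\alpha,\overline\beta^h)$; $\Omega_D=\{\alpha+\beta J\}$ open. $T$-stem functions $F=\sum_KE_KF_K:D\to A\otimes\mathbb R^{2^\tau}$ satisfy $F_K(\alpha,\overline\beta^h)=F_K(\alpha,\beta)$ if $h\notin K$, $-F_K(\alpha,\beta)$ if $h\in K$, and induce $\mathcal I(F)(\alpha+\beta J)=\sum_KJ_KF_K(\alpha,\beta)$ ($\mathcal I$ injective); $\mathcal S^p_T(\Omega_D,A)$ is the image of stems with $C^p$ components. Slice operators: $\mathbb R_J=\mathrm{Span}(v_0,\dots,v_{t_0},J_1,\dots,J_\tau)$; on $C^1$ functions on open subsets of $\mathbb R_J$, $\partial_s$ ($s\le t_0$) and $\partial_{t_0+u}$ ($1\le u\le\tau$) are directional derivatives along $v_s$ and $J_u$; $\overline\partial_J=\sum_{s=0}^{t_0}v_s\partial_s+\sum_uJ_u\partial_{t_0+u}$, $\partial_J=\partial_0-\sum_{s=1}^{t_0}v_s\partial_s-\sum_uJ_u\partial_{t_0+u}$, $\Delta_J=\sum_{s=0}^{t_0+\tau}\partial_s^2$. Global operators: with $\alpha=\sum_{s=0}^{t_0}x_sv_s$, $\partial_{\alpha_s},\partial_{\beta_h}$ partial derivatives on $D$; $\overline\partial_\alpha=\partial_{\alpha_0}+\sum_{s\ge1}v_s\partial_{\alpha_s}$, $\partial_\alpha=\partial_{\alpha_0}-\sum_{s\ge1}v_s\partial_{\alpha_s}$,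 $\overline\partial^u_\alpha=\partial_{\alpha_0}-(-1)^u\sum_{s=1}^{t_0}v_s\partial_{\alpha_s}$; $(\overline\partial_TF)_K=\overline\partial^{|K|+1}_\alpha F_K+\sum_h(-1)^{\sigma(h,K)+1}\partial_{\beta_h}F_{K\triangle\{h\}}$, $(\partial_TF)_K=\overline\partial^{|K|}_\alpha F_K+\sum_h(-1)^{\sigma(h,K)}\partial_{\beta_h}F_{K\triangle\{h\}}$, $(\Delta_TF)_K=\partial_\alpha\overline\partial_\alpha F_K+\sum_h\partial^2_{\beta_h}F_K$; on $T$-functions, $\overline\partial_T\mathcal I(F)=\mathcal I(\overline\partial_TF)$, $\partial_T\mathcal I(F)=\mathcal I(\partial_TF)$, $\Delta_T\mathcal I(F)=\mathcal I(\Delta_TF)$. *)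

(* Defs.v *)
From mathcomp Require Import all_boot all_algebra all_field.
From mathcomp Require Import all_classical all_reals all_analysis.
Set Implicit Arguments.
Unset Strict Implicit.
Unset Printing Implicit Defensive.
Import GRing.Theory Num.Theory numFieldNormedType.Exports.
Local Open Scope ring_scope.
Local Open Scope classical_set_scope.

Section SliceDefs.
Context {R : realType} {A : falgType R}.

(* Coordinates of the finite-dimensional real vector space A, used only to
   transport the (unique) Hausdorff vector-space topology of A, hence to
   define derivatives of A-valued functions. *)
Definition crd (x : A) : 'rV[R]_(dim A) := VectorInternalTheory.v2r x.
Definition uncrd (r : 'rV[R]_(dim A)) : A := VectorInternalTheory.r2v r.

Definition star_involution (cj : A -> A) : Prop :=
  (forall (a : R) (x y : A), cj (a *: x + y) = a *: cj x + cj y) /\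
  (forall x y : A, cj (x * y) = cj y * cj x) /\
  (forall x : A, cj (cj x) = x).

Definition in_SA (cj : A -> A) (x : A) : Prop := x + cj x = 0 /\ x * cj x = 1.

Definition in_span (v : nat -> A) (l m : nat) (x : A) : Prop :=
  exists c : nat -> R, x = \sum_(l <= s < m.+1) c s *: v s.

(* x \in S_{l,m}: unit sphere of R_{l,m} for the Euclidean norm making
   (v_0, ..., v_N) orthonormal *)
Definition in_sphere (v : nat -> A) (l m : nat) (x : A) : Prop :=
  exists c : nat -> R, x = \sum_(l <= s < m.+1) c s *: v s /\
                       \sum_(l <= s < m.+1) c s ^+ 2 = 1.

(* ---------- the torus (indices h = 1..tau are shifted to 'I_tau) ---------- *)
Definition in_torus (v : nat -> A) (t : nat -> nat) (tau : nat)
  (J : 'I_tau -> A) : Prop :=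
  forall h : 'I_tau, in_sphere v (t h).+1 (t h.+1) (J h).

Definition in_RJ (v : nat -> A) (t : nat -> nat) (tau : nat)
  (J : 'I_tau -> A) (y : A) : Prop :=
  exists (a : nat -> R) (b : 'I_tau -> R),
    y = \sum_(s < (t 0%N).+1) a s *: v s + \sum_(h < tau) b h *: J h.

(* points (alpha, beta) of R_{0,t_0} x R^tau, alpha given by its coordinates
   x_0..x_{t_0} : alpha = sum_s x_s v_s *)
Local Notation Pt t tau := ('rV[R]_(t 0%N).+1 * 'rV[R]_tau)%type.

Definition alpha_of (v : nat -> A) (t : nat -> nat) (x : 'rV[R]_(t 0%N).+1) : A :=
  \sum_(s < (t 0%N).+1) x 0 s *: v s.

Definition tpt (v : nat -> A) (t : nat -> nat) (tau : nat) (p : Pt t tau)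
  (J : 'I_tau -> A) : A :=
  alpha_of v p.1 + \sum_(h < tau) p.2 0 h *: J h.

Definition bflip (tau : nat) (h : 'I_tau) (b : 'rV[R]_tau) : 'rV[R]_tau :=
  \row_j (if j == h then - b 0 j else b 0 j).

Definition JK (tau : nat) (J : 'I_tau -> A) (K : {set 'I_tau}) : A :=
  \prod_(k < tau | k \in K) J k.

(* T-stem functions F = sum_K E_K F_K on D *)
Definition is_stem (t : nat -> nat) (tau : nat) (D : set (Pt t tau))
  (F : {set 'I_tau} -> Pt t tau -> A) : Prop :=
  forall (K : {set 'I_tau}) (h : 'I_tau) (p : Pt t tau), D p ->
    F K (p.1, bflip h p.2) = (if h \in K then - F K p else F K p).

Definition stemI (t : nat -> nat) (tau : nat)
  (F : {set 'I_tau} -> Pt t tau -> A) (p : Pt t tau) (J : 'I_tau -> A) : A :=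
  \sum_(K : {set 'I_tau}) JK J K * F K p.

Definition ea (t : nat -> nat) (tau : nat) (s : 'I_(t 0%N).+1) : Pt t tau :=
  (delta_mx 0 s, 0).
Definition eb (t : nat -> nat) (tau : nat) (h : 'I_tau) : Pt t tau :=
  (0, delta_mx 0 h).

Definition coord_dir (t : nat -> nat) (tau : nat) (e : Pt t tau) : Prop :=
  (exists s, e = ea tau s) \/ (exists h, e = eb t h).

Definition pder (t : nat -> nat) (tau : nat) (g : Pt t tau -> A)
  (e : Pt t tau) : Pt t tau -> A :=
  fun p => uncrd ('D_e (crd \o g) p).

Definition C1 (t : nat -> nat) (tau : nat) (D : set (Pt t tau))
  (g : Pt t tau -> A) : Prop :=
  (forall p, D p -> {for p, continuous (crd \o g)}) /\
  (forall e, coord_dir e ->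
     (forall p, D p -> derivable (crd \o g) p e) /\
     (forall p, D p -> {for p, continuous (fun q => 'D_e (crd \o g) q)})).

Definition C2 (t : nat -> nat) (tau : nat) (D : set (Pt t tau))
  (g : Pt t tau -> A) : Prop :=
  C1 D g /\ (forall e, coord_dir e -> C1 D (pder g e)).

Definition pdA (t : nat -> nat) (tau : nat) (g : Pt t tau -> A)
  (s : 'I_(t 0%N).+1) := pder g (ea tau s).
Definition pdB (t : nat -> nat) (tau : nat) (g : Pt t tau -> A)
  (h : 'I_tau) := pder g (eb t h).

Definition dbarU (v : nat -> A) (t : nat -> nat) (tau : nat) (u : nat)
  (g : Pt t tau -> A) : Pt t tau -> A :=
  fun p => pdA g ord0 p -
    (-1) ^+ u *: \sum_(s < (t 0%N).+1 | (0 < s)%N) v s * pdA g s p.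

Definition dbarA (v : nat -> A) (t : nat -> nat) (tau : nat)
  (g : Pt t tau -> A) : Pt t tau -> A :=
  fun p => pdA g ord0 p + \sum_(s < (t 0%N).+1 | (0 < s)%N) v s * pdA g s p.
Definition dA (v : nat -> A) (t : nat -> nat) (tau : nat)
  (g : Pt t tau -> A) : Pt t tau -> A :=
  fun p => pdA g ord0 p - \sum_(s < (t 0%N).+1 | (0 < s)%N) v s * pdA g s p.

Definition sgnT (tau : nat) (h : 'I_tau) (K : {set 'I_tau}) : R :=
  (-1) ^+ (odd #|[set k in K | (k <= h)%N]|).

Definition symd (tau : nat) (K : {set 'I_tau}) (h : 'I_tau) : {set 'I_tau} :=
  (K :\: [set h]) :|: ([set h] :\: K).

Definition dbarT (v : nat -> A) (t : nat -> nat) (tau : nat)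
  (F : {set 'I_tau} -> Pt t tau -> A) : {set 'I_tau} -> Pt t tau -> A :=
  fun K p => dbarU v (#|K|.+1) (F K) p +
    \sum_(h < tau) ((-1) * sgnT h K) *: pdB (F (symd K h)) h p.
Definition dT (v : nat -> A) (t : nat -> nat) (tau : nat)
  (F : {set 'I_tau} -> Pt t tau -> A) : {set 'I_tau} -> Pt t tau -> A :=
  fun K p => dbarU v #|K| (F K) p +
    \sum_(h < tau) sgnT h K *: pdB (F (symd K h)) h p.
Definition LapT (v : nat -> A) (t : nat -> nat) (tau : nat)
  (F : {set 'I_tau} -> Pt t tau -> A) : {set 'I_tau} -> Pt t tau -> A :=
  fun K p => dA v (dbarA v (F K)) p + \sum_(h < tau) pdB (pdB (F K) h) h p.

(* directional derivative of f at y along w (w in R_J, so that this is a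
   derivative of the restriction f_J) *)
Definition dirder (f : A -> A) (y w : A) : A :=
  uncrd (derive1 (fun r : R => crd (f (y + r *: w))) 0).
Definition dirder2 (f : A -> A) (y w : A) : A :=
  dirder (fun z => dirder f z w) y w.

Definition dbarJ (v : nat -> A) (t : nat -> nat) (tau : nat)
  (J : 'I_tau -> A) (f : A -> A) (y : A) : A :=
  \sum_(s < (t 0%N).+1) v s * dirder f y (v s) +
  \sum_(u < tau) J u * dirder f y (J u).
Definition dJ (v : nat -> A) (t : nat -> nat) (tau : nat)
  (J : 'I_tau -> A) (f : A -> A) (y : A) : A :=
  dirder f y (v 0%N) -
  \sum_(s < (t 0%N).+1 | (0 < s)%N) v s * dirder f y (v s) -
  \sum_(u < tau) J u * dirder f y (J u).
Definition LapJ (v : nat -> A) (t : nat -> nat) (tau : nat)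
  (J : 'I_tau -> A) (f : A -> A) (y : A) : A :=
  \sum_(s < (t 0%N).+1) dirder2 f y (v s) +
  \sum_(u < tau) dirder2 f y (J u).

End SliceDefs.

(* Main.v *)
(** On a slice, write a point as alpha + beta J.  Since J is fixed, the derivative
    of f_J along v_s or J_u is the sum over K of J_K times the corresponding partial
    derivative of F_K.  The signs in dbarT and dT are exactly those produced by
    v_s J_K = (-1)^|K| J_K v_s and J_h J_K = +- J_(K sym. diff. {h}), while in the
    Laplacian the mixed terms cancel because the v_s anticommute and second partial
    derivatives commute.

    A point of Omega_D lying in R_J may be presented with another J' of the torus.
    By linear independence the two presentations differ by sign flips of the beta_h,
    except that J'_h is arbitrary where beta_h = 0.  As dbarT F, dT F and LapT F are
    again stem functions, the functions they induce do not see the difference. *)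

From HB Require Import structures.
Require Import Defs.
From mathcomp Require Import all_boot all_order all_algebra all_field.
From mathcomp Require Import all_classical all_reals all_analysis.
From mathcomp Require Import ring.
Set Implicit Arguments.
Unset Strict Implicit.
Unset Printing Implicit Defensive.
Import Order.TTheory GRing.Theory Num.Theory numFieldNormedType.Exports.
Local Open Scope ring_scope.
Local Open Scope classical_set_scope.

(** * Directional derivatives of real functions and symmetry of mixed derivatives *)

Section DirectionalDerivatives.
Context {R : realType} {V : normedModType R}.

Lemma is_derive_mxP {m n : nat} (M : V -> 'M[R]_(m, n)) (p e : V)
    (d : 'M[R]_(m, n)) :
  is_derive p e M d <-> forall i j, is_derive p e (fun x => M x i j) (d i j).
Proof.
split=> [[dM <-] i j | dM].
  rewrite derive_mx// mxE; apply: DeriveDef => //.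
  exact: (derivable_mxP _ _ _).1.
have dM' : derivable M p e by apply/derivable_mxP => i j; case: (dM i j).
apply: DeriveDef => //; rewrite derive_mx//; apply/matrixP => i j.
by rewrite mxE; case: (dM i j).
Qed.

Lemma is_derive_line (f : V -> R) (p e : V) (r d : R) :
  is_derive (p + r *: e) e f d ->
  is_derive r (1 : R) (fun s : R => f (p + s *: e)) d.
Proof.
have E : (fun h : R => h^-1 *: (((fun s : R => f (p + s *: e)) \o shift r) (h *: 1)
      - f (p + r *: e))) =
    (fun h : R => h^-1 *: ((f \o shift (p + r *: e)) (h *: e) - f (p + r *: e))).
  apply/funext => h /=; congr (_ *: (f _ - _)).
  by rewrite [h%:A]mulr1 scalerDl addrCA.
by case=> df dE; split; rewrite /derivable /derive E.
Qed.

Lemma is_derive_lineP (f : V -> R) (p e : V) (d : R) :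
  is_derive p e f d <-> is_derive (0 : R) (1 : R) (fun s : R => f (p + s *: e)) d.
Proof.
split=> [|[df dE]]; first by move=> H; apply: is_derive_line; rewrite scale0r addr0.
have E : (fun h : R => h^-1 *: (((fun s : R => f (p + s *: e)) \o shift 0) (h *: 1)
      - f (p + 0 *: e))) =
    (fun h : R => h^-1 *: ((f \o shift p) (h *: e) - f p)).
  apply/funext => h /=; rewrite scale0r !addr0; congr (_ *: (f _ - _)).
  by rewrite [h%:A]mulr1 addrC.
by move: df dE; rewrite /derivable /derive E => df dE; split.
Qed.

(** The mean value theorem is applied twice: to the increment [phi] of [g] along [e2] as a function
    of the [e1] coordinate, then to [psi], the values of ['D_e1 g] along [e2]. The derivatives need
    only exist on the closed parallelogram. *)
Lemma mixed_difference (g : V -> R) (B : set V) (p e1 e2 : V) (h : R) : 0 < h ->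
  (forall a b, 0 <= a <= h -> 0 <= b <= h -> B (p + a *: e1 + b *: e2)) ->
  (forall q, B q -> derivable g q e1) ->
  (forall q, B q -> derivable ('D_e1 g) q e2) ->
  exists a b, [/\ 0 <= a <= h, 0 <= b <= h &
    g (p + h *: e1 + h *: e2) - g (p + h *: e1) - (g (p + h *: e2) - g p) =
    'D_e2 ('D_e1 g) (p + a *: e1 + b *: e2) * h * h].
Proof.
move=> h0 hB dg ddg.
have lin x y z : x + y *: e1 + z *: e2 = x + z *: e2 + y *: e1 :> V by rewrite addrAC.
pose phi a := g (p + a *: e1 + h *: e2) - g (p + a *: e1).
have hh : 0 <= h <= h by rewrite lexx ltW.
have h00 : 0 <= (0 : R) <= h by rewrite lexx ltW.
have dphi a : 0 <= a <= h -> is_derive a (1 : R) phi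
   ('D_e1 g (p + a *: e1 + h *: e2) - 'D_e1 g (p + a *: e1)).
  move=> ah; apply: is_deriveB.
    have -> : (fun a0 => g (p + a0 *: e1 + h *: e2)) =
      (fun a0 => g (p + h *: e2 + a0 *: e1)) by apply/funext => x; rewrite lin.
    by apply: is_derive_line; rewrite -lin; apply/derivableP/dg/hB.
  apply: is_derive_line; apply/derivableP/dg.
  by have := hB a 0 ah h00; rewrite scale0r addr0.
have cont (f df : R -> R) : (forall a, 0 <= a <= h -> is_derive a (1 : R) f (df a)) ->
    {within `[0, h], continuous f}.
  move=> fdf; apply: derivable_within_continuous => x; rewrite in_itv/= => xh.
  by have [] := fdf _ xh.
have [||a] := MVT h0 (f := phi) (df := fun a => 'D_e1 g (p + a *: e1 + h *: e2) - 'D_e1 g (p + a *: e1)).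
- by move=> x; rewrite in_itv/= => /andP[x0 xh]; apply: dphi; rewrite !ltW.
- exact: cont dphi.
rewrite in_itv/= => /andP[a0 ah] Ea.
have a0h : 0 <= a <= h by rewrite !ltW.
pose psi b := 'D_e1 g (p + a *: e1 + b *: e2).
have dpsi b : 0 <= b <= h -> is_derive b (1 : R) psi ('D_e2 ('D_e1 g) (p + a *: e1 + b *: e2)).
  by move=> bh; apply: (@is_derive_line ('D_e1 g) (p + a *: e1)); apply/derivableP/ddg/hB.
have [||b] := MVT h0 (f := psi) (df := fun b => 'D_e2 ('D_e1 g) (p + a *: e1 + b *: e2)).
- by move=> x; rewrite in_itv/= => /andP[x0 xh]; apply: dpsi; rewrite !ltW.
- exact: cont dpsi.
rewrite in_itv/= => /andP[b0 bh] Eb.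
exists a, b; split; rewrite ?a0h ?ltW//.
move: Ea Eb; rewrite /phi /psi !scale0r !addr0 !subr0 => ->.
by move=> ->.
Qed.

Lemma dist_lt_half (eps x y z : R) :
  `|x - z| < eps / 2 -> `|y - z| < eps / 2 -> `|x - y| <= eps.
Proof.
move=> xz yz; rewrite -(subrKA z) [leRHS](splitr eps) (le_trans (ler_normD _ _))//.
by rewrite lerD// ltW// distrC.
Qed.

Lemma derive_mixed_sym (g : V -> R) (D : set V) (p e1 e2 : V) :
  open D -> D p ->
  (forall q, D q -> derivable g q e1) ->
  (forall q, D q -> derivable g q e2) ->
  (forall q, D q -> derivable ('D_e1 g) q e2) ->
  (forall q, D q -> derivable ('D_e2 g) q e1) ->
  {for p, continuous ('D_e2 ('D_e1 g))} ->
  {for p, continuous ('D_e1 ('D_e2 g))} ->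
  'D_e2 ('D_e1 g) p = 'D_e1 ('D_e2 g) p.
Proof.
move=> oD Dp dg1 dg2 dg12 dg21 c12 c21.
apply/eqP; rewrite -subr_eq0 -normr_le0; apply/ler_addgt0Pl => eps eps0.
rewrite addr0.
have eps2 : 0 < eps / 2 by rewrite divr_gt0.
have /cvgrPdist_lt/(_ _ eps2) n12 := c12.
have /cvgrPdist_lt/(_ _ eps2) n21 := c21.
have nD : nbhs p D by apply: open_nbhs_nbhs; split.
have [d /= d0 dB] := (nbhs_normP _ _).1 (filterI nD (filterI n12 n21)).
have M0 : 0 < `|e1| + `|e2| + 1 by rewrite ltr_wpDl// addr_ge0.
(* This [h] keeps the whole parallelogram within [d / 2], hence strictly within [d], of [p]. The
   summand [1] keeps the denominator positive when both directions vanish. *)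
pose h := d / 2 / (`|e1| + `|e2| + 1).
have h0 : 0 < h by rewrite !divr_gt0.
have box a b : 0 <= a <= h -> 0 <= b <= h -> `|p - (p + a *: e1 + b *: e2)| < d.
  move=> /andP[a0 ah] /andP[b0 bh].
  rewrite -addrA opprD addNKr normrN.
  apply: (@le_lt_trans _ _ (h * (`|e1| + `|e2| + 1))); last first.
    by rewrite /h divfK ?gt_eqF// ltr_pdivrMr// ltr_pMr// ltrDl.
  rewrite (le_trans (ler_normD _ _))// !normrZ !ger0_norm//.
  by rewrite mulrDr mulr1 -[leLHS]addr0 mulrDr !lerD// ?ler_wpM2r// ltW.
have B q (Bq : `|p - q| < d) := dB q Bq.
have [a [b [ah bh E12]]] := @mixed_difference g (fun q => `|p - q| < d) p e1 e2 h h0 box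
  (fun q Bq => dg1 q (B q Bq).1) (fun q Bq => dg12 q (B q Bq).1).
have box' b' a' : 0 <= b' <= h -> 0 <= a' <= h -> `|p - (p + b' *: e2 + a' *: e1)| < d.
  by move=> bh' ah'; rewrite addrAC; apply: box.
have [b' [a' [bh' ah' E21]]] := @mixed_difference g (fun q => `|p - q| < d) p e2 e1 h h0 box'
  (fun q Bq => dg2 q (B q Bq).1) (fun q Bq => dg21 q (B q Bq).1).
have E : 'D_e2 ('D_e1 g) (p + a *: e1 + b *: e2) =
         'D_e1 ('D_e2 g) (p + b' *: e2 + a' *: e1).
  apply: (mulIf (lt0r_neq0 h0)); apply: (mulIf (lt0r_neq0 h0)).
  have sw (x y z w : R) : x - y - (z - w) = x - z - (y - w) by ring.
  apply: etrans (esym E12) _; apply: etrans _ E21.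
  by rewrite [p + h *: e2 + h *: e1]addrAC; exact: sw.
have [_ [N12 _]] := B _ (box _ _ ah bh).
have [_ [_ N21]] := B _ (box' _ _ bh' ah').
by apply: dist_lt_half N12 _; rewrite E; exact: N21.
Qed.

End DirectionalDerivatives.

(** * Derivatives of functions with values in the algebra *)

Section AlgebraValuedDerivatives.
Context {R : realType} {A : falgType R}.

Lemma crdK : cancel (@crd R A) uncrd.
Proof. exact: VectorInternalTheory.v2rK. Qed.

Lemma uncrdK : cancel (@uncrd R A) crd.
Proof. exact: VectorInternalTheory.r2vK. Qed.

Lemma crd_is_linear : linear (@crd R A).
Proof.
have [hZ hD] := v2r_semilinear (@VectorInternalTheory.v2r_subproof R A).
by move=> a x y; apply: etrans (hD (a *: x) y) _; congr (_ + _); exact: hZ.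
Qed.

HB.instance Definition _ :=
  GRing.isLinear.Build R A 'rV[R]_(dim A) *:%R (@crd R A) crd_is_linear.

Lemma crd_linear_coord (L : {linear A -> A}) (x : A) j :
  crd (L x) 0 j = \sum_i crd (L (uncrd (delta_mx 0 i))) 0 j * crd x 0 i.
Proof.
have E : x = \sum_i crd x 0 i *: uncrd (delta_mx 0 i).
  apply: (can_inj crdK); rewrite linear_sum [LHS]row_sum_delta.
  by apply: eq_bigr => i _; rewrite linearZ/= uncrdK.
rewrite [in LHS]E !linear_sum summxE; apply: eq_bigr => i _.
by rewrite !linearZ/= mxE mulrC.
Qed.

(** Existence and value of the derivative in one relation, stated on coordinate vectors because [A]
    itself carries no norm here. *)
Definition has_dder (V : normedModType R) (g : V -> A) (p e : V) (d : A) :=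
  is_derive p e (crd \o g) (crd d).

Section OneDomain.
Context {V : normedModType R}.
Implicit Types (g : V -> A) (p e : V) (d : A).

Lemma has_dderP g p e d : has_dder g p e d <->
  forall i, is_derive p e (fun q => crd (g q) 0 i) (crd d 0 i).
Proof.
split=> [/is_derive_mxP H i|H]; first exact: H.
by apply/is_derive_mxP => i j; rewrite ord1; exact: H.
Qed.

(** Each coordinate of [L \o g] is a combination, with constant coefficients, of the coordinates of
    [g]. Left multiplication by a constant and real scaling are the instances used later. *)
Lemma has_dder_linear (L : {linear A -> A}) g p e d :
  has_dder g p e d -> has_dder (L \o g) p e (L d).
Proof.
move=> /has_dderP dg; apply/has_dderP => j.
rewrite crd_linear_coord /=.
have -> : (fun q => crd (L (g q)) 0 j) = \sum_i
    (crd (L (uncrd (delta_mx 0 i))) 0 j \*: (fun q => crd (g q) 0 i)).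
  by apply/funext => q; rewrite fct_sumE crd_linear_coord.
by apply: is_derive_sum => i; apply: is_deriveZ.
Qed.

Lemma has_dder_add g1 g2 p e d1 d2 : has_dder g1 p e d1 -> has_dder g2 p e d2 ->
  has_dder (fun q => g1 q + g2 q) p e (d1 + d2).
Proof.
rewrite /has_dder => H1 H2; rewrite linearD.
have -> : crd \o (fun q => g1 q + g2 q) = (crd \o g1) + (crd \o g2).
  by apply/funext => q /=; rewrite linearD.
exact: is_deriveD.
Qed.

Lemma has_dder_cst a p e : has_dder (fun=> a) p e 0.
Proof. by rewrite /has_dder linear0; apply: is_derive_cst. Qed.

Lemma has_dder_sum (I : Type) (r : seq I) (P : pred I) (g : I -> V -> A) p e (d : I -> A) :
  (forall i, P i -> has_dder (g i) p e (d i)) ->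
  has_dder (fun q => \sum_(i <- r | P i) g i q) p e (\sum_(i <- r | P i) d i).
Proof.
move=> dg; elim: r => [|i r IH].
  rewrite big_nil; under eq_fun do rewrite big_nil; exact: has_dder_cst.
rewrite big_cons; under eq_fun do rewrite big_cons.
by case: ifP => // Pi; apply: has_dder_add => //; apply: dg.
Qed.

Lemma has_dder_mull a g p e d : has_dder g p e d ->
  has_dder (fun q => a * g q) p e (a * d).
Proof. exact: (has_dder_linear (a \*o @idfun A)). Qed.

Lemma has_dder_scale (k : R) g p e d : has_dder g p e d ->
  has_dder (fun q => k *: g q) p e (k *: d).
Proof. exact: (has_dder_linear (k \*: idfun)). Qed.

Lemma has_dder_near g1 g2 p e d : (\near p, g1 p = g2 p) ->
  has_dder g1 p e d -> has_dder g2 p e d.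
Proof. by move=> E; apply: near_eq_is_derive; apply: filterS E => q /= ->. Qed.

End OneDomain.

Section Lines.
Context {V : normedModType R}.
Implicit Types (g : V -> A) (p e : V) (d : A).

Lemma has_dder_lineP g p e d :
  has_dder g p e d <-> has_dder (fun s : R => g (p + s *: e)) 0 1 d.
Proof.
split=> /has_dderP H; apply/has_dderP => i; move: (H i);
  by move/(is_derive_lineP (fun q => crd (g q) 0 i)).
Qed.

Lemma has_dder_scale_dir g p e d (k : R) :
  has_dder g p e d -> has_dder g p (k *: e) (k *: d).
Proof.
move=> /has_dderP H; apply/has_dderP => i.
apply/(is_derive_lineP (fun q => crd (g q) 0 i)).
have /(is_derive_lineP (fun q => crd (g q) 0 i)) := H i.
(* The base point [0] is written as [k * 0], as the chain rule for [s |-> k * s] expects. *)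
rewrite -{1}(mulr0 k) => H1.
have -> : (fun s : R => crd (g (p + s *: (k *: e))) 0 i) =
   (fun s : R => crd (g (p + s *: e)) 0 i) \o ( *%R k).
  by apply/funext => s /=; rewrite scalerA mulrC.
rewrite linearZ mxE mulrC; apply: is_derive1_comp.
by rewrite -{2}[k]mulr1; apply: is_deriveZ.
Qed.

(** Transports a symmetry of [g] to its derivatives: [phi] carries a line with direction [e] to one
    with direction [k *: e], while [g] is multiplied by [c]. It is applied to the flips of one
    [beta_h]. *)
Lemma has_dder_equivariant (phi : V -> V) (c k : R) g p e d :
  (forall s : R, phi (p + s *: e) = phi p + s *: (k *: e)) ->
  (\forall s \near (0 : R), g (phi (p + s *: e)) = c *: g (p + s *: e)) ->
  has_dder g p e d -> has_dder g (phi p) (k *: e) (c *: d).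
Proof.
move=> phiE gE /has_dder_lineP/(has_dder_scale c) H; apply/has_dder_lineP.
apply: has_dder_near H; near=> s; rewrite -phiE; apply/esym; near: s; exact: gE.
Unshelve. all: by end_near. Qed.

End Lines.

Lemma has_dder_dirder (f : A -> A) (y w d : A) :
  has_dder (fun r : R => f (y + r *: w)) 0 1 d -> dirder f y w = d.
Proof. by move=> [_ H]; rewrite /dirder derive1E H crdK. Qed.

End AlgebraValuedDerivatives.

(** * Sums with anticommuting coefficients *)

Section SymmetricSums.
Context {R : realType} {A : falgType R}.

(* The off-diagonal terms cancel in pairs: [w] anticommutes while [H] is symmetric. *)
Lemma anticommuting_symmetric_sum (I : finType) (P : pred I) (w : I -> A) (H : I -> I -> A) :
  (forall i, P i -> w i * w i = -1) ->
  (forall i j, P i -> P j -> i != j -> w i * w j = - (w j * w i)) ->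
  (forall i j, P i -> P j -> H i j = H j i) ->
  \sum_(i | P i) w i * (\sum_(j | P j) w j * H i j) = - \sum_(i | P i) H i i.
Proof.
move=> wsq wac Hsym; set X := LHS; set Y := \sum_(i | P i) H i i.
have E1 : X = \sum_(i | P i) \sum_(j | P j) w i * w j * H i j.
  by apply: eq_bigr => i _; rewrite mulr_sumr; apply: eq_bigr => j _; rewrite mulrA.
have E2 : X = \sum_(i | P i) \sum_(j | P j) w j * w i * H i j.
  rewrite E1 exchange_big/=; apply: eq_bigr => i Pi; apply: eq_bigr => j Pj.
  by rewrite Hsym.
have E3 : X + X = - (Y + Y).
  rewrite {1}E1 E2 -big_split/= -big_split/= -sumrN; apply: eq_bigr => i Pi.
  rewrite -big_split/= (bigD1 i)//= big1 ?addr0; last first.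
    by move=> j /andP[Pj ji]; rewrite -mulrDl wac ?addNr ?mul0r// eq_sym.
  by rewrite wsq// mulN1r opprD.
apply/eqP; rewrite -addr_eq0.
have : 2%:R *: (X + Y) == 0.
  by rewrite scaler_nat mulr2n addrACA E3 addNr.
by rewrite scaler_eq0 pnatr_eq0.
Qed.

(** The algebra behind the factorisation of the Laplacian, with [H] standing for the second partial
    derivatives. Terms containing [ord0] once cancel by symmetry of [H]; the remaining double sum is
    minus its diagonal, and the outer minus sign makes it positive. *)
Lemma dirac_square n (v : nat -> A) (H : 'I_n.+1 -> 'I_n.+1 -> A) :
  (forall s : nat, (0 < s <= n)%N -> v s * v s = -1) ->
  (forall s s' : nat, (0 < s <= n)%N -> (0 < s' <= n)%N -> s != s' ->
     v s * v s' = - (v s' * v s)) ->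
  (forall s s', H s s' = H s' s) ->
  H ord0 ord0 + \sum_(s < n.+1 | (0 < s)%N) v s * H ord0 s -
    \sum_(s < n.+1 | (0 < s)%N)
       v s * (H s ord0 + \sum_(s' < n.+1 | (0 < s')%N) v s' * H s s') =
  \sum_s H s s.
Proof.
move=> vsq vac Hsym; under [X in _ - X]eq_bigr do rewrite mulrDr.
rewrite big_split/= anticommuting_symmetric_sum => [|s s0|s s' s0 s'0 ss'|//].
- under [X in _ - (X + _)]eq_bigr do rewrite Hsym.
  rewrite opprD opprK addrA addrK [RHS](bigD1 ord0)//=; congr (_ + _).
  by apply: eq_bigl => s; rewrite lt0n.
- by apply: vsq; rewrite s0 -ltnS ltn_ord.
- by apply: vac => //; rewrite ?s0 ?s'0 -ltnS ltn_ord.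
Qed.

End SymmetricSums.

(** * Partial derivatives of stem components: commutation and parity *)

Section StemCalculus.
Context {R : realType} {A : falgType R} {t : nat -> nat} {tau : nat}.
Local Notation Pt := ('rV[R]_(t 0%N).+1 * 'rV[R]_tau)%type.
Implicit Types (g : Pt -> A) (p e : Pt) (D : set Pt).

Lemma near_open_line D p e : open D -> D p -> \forall s \near (0 : R), D (p + s *: e).
Proof.
move=> oD Dp.
have c : {for (0 : R), continuous (fun s : R => p + s *: e)}.
  by move=> ?; apply: cvgD; [exact: cvg_cst|apply: cvgZr_tmp; exact: cvg_id].
by apply: c; rewrite scale0r addr0; apply: open_nbhs_nbhs.
Qed.

Lemma C1_has_dder D g p e : C1 D g -> D p -> coord_dir e -> has_dder g p e (pder g e p).
Proof.
move=> [_ dg] Dp ce; rewrite /has_dder /pder uncrdK; apply: derivableP.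
by have [d _] := dg e ce; apply: d.
Qed.

Lemma has_dder_pder g p e d : has_dder g p e d -> pder g e p = d.
Proof. by move=> [_ H]; rewrite /pder H crdK. Qed.

Lemma coord_dir_ea s : coord_dir (ea tau s : Pt).
Proof. by left; exists s. Qed.

Lemma coord_dir_eb (h : 'I_tau) : coord_dir (eb t h : Pt).
Proof. by right; exists h. Qed.

(** Reduces to the real-valued case in each coordinate. A coordinate of [pder g e] is known to be
    the derivative of that coordinate of [g] only on [D], so second derivatives and their continuity
    are transferred along equalities holding near points of the open set [D]. *)
Lemma pder_comm D g p e1 e2 : open D -> C2 D g -> D p ->
  coord_dir e1 -> coord_dir e2 ->
  pder (pder g e1) e2 p = pder (pder g e2) e1 p.
Proof.
move=> oD [g1 g2] Dp ce1 ce2.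
pose gi i q := crd (g q) 0 i.
have crdD e q i : coord_dir e -> D q -> crd (pder g e q) 0 i = 'D_e (gi i) q.
  move=> ce Dq; have /has_dderP/(_ i)[_ <-] := C1_has_dder g1 Dq ce.
  by [].
have near_eq e q i : coord_dir e -> D q ->
    \forall x \near q, crd (pder g e x) 0 i = 'D_e (gi i) x.
  move=> ce Dq; apply: filterS (open_nbhs_nbhs (conj oD Dq)) => x Dx.
  exact: crdD.
have dd e e' q i : coord_dir e -> coord_dir e' -> D q ->
    is_derive q e' ('D_e (gi i)) (crd (pder (pder g e) e' q) 0 i).
  move=> ce ce' Dq; apply: near_eq_is_derive (near_eq e q i ce Dq) _.
  by have /has_dderP/(_ i) := C1_has_dder (g2 e ce) Dq ce'.
have cont e e' i : coord_dir e -> coord_dir e' ->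
    {for p, continuous ('D_e' ('D_e (gi i)))}.
  move=> ce ce'.
  have [_ /(_ e' ce')[_ /(_ p Dp) c]] := g2 e ce.
  have c' : {for p, continuous (fun q => crd (pder (pder g e) e' q) 0 i)}.
    have -> : (fun q => crd (pder (pder g e) e' q) 0 i) =
        (fun M : 'rV[R]_(dim A) => M 0 i) \o ('D_e' (crd \o pder g e)).
      by apply/funext => q /=; rewrite /pder uncrdK.
    by apply: continuous_comp; [exact: c|exact: coord_continuous].
  rewrite /prop_for /continuous_at (@derive_val _ _ _ _ _ _ _ (dd e e' p i ce ce' Dp)).
  apply: cvg_trans c'; apply: near_eq_cvg.
  apply: filterS (open_nbhs_nbhs (conj oD Dp)) => x Dx /=.
  by rewrite (@derive_val _ _ _ _ _ _ _ (dd e e' x i ce ce' Dx)).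
apply: (can_inj crdK); apply/rowP => i.
have [_ E1] := dd e1 e2 p i ce1 ce2 Dp.
have [_ E2] := dd e2 e1 p i ce2 ce1 Dp.
apply: etrans (esym E1) _; apply: etrans _ E2.
have d1 e q : coord_dir e -> D q -> derivable (gi i) q e.
  by move=> ce Dq; have /has_dderP/(_ i)[] := C1_has_dder g1 Dq ce.
apply: (derive_mixed_sym oD Dp); [| | | |exact: cont|exact: cont] => q Dq.
- exact: d1.
- exact: d1.
- by have [] := dd e1 e2 q i ce1 ce2 Dq.
- by have [] := dd e2 e1 q i ce2 ce1 Dq.
Qed.

Lemma dA_dbarA D (v : nat -> A) g p : open D -> C2 D g -> D p ->
  (forall s : nat, (0 < s <= t 0)%N -> v s * v s = -1) ->
  (forall s s' : nat, (0 < s <= t 0)%N -> (0 < s' <= t 0)%N -> s != s' ->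
     v s * v s' = - (v s' * v s)) ->
  dA v (dbarA v g) p = \sum_s pdA (pdA g s) s p.
Proof.
move=> oD g2 Dp vsq vac.
have d2 s s' : has_dder (pdA g s) p (ea tau s') (pdA (pdA g s) s' p).
  exact: (C1_has_dder (g2.2 _ (coord_dir_ea s)) Dp (coord_dir_ea s')).
have E s' : pdA (dbarA v g) s' p = pdA (pdA g ord0) s' p +
    \sum_(s < (t 0%N).+1 | (0 < s)%N) v s * pdA (pdA g s) s' p.
  apply: has_dder_pder; apply: has_dder_add; first exact: d2.
  by apply: has_dder_sum => s _; apply: has_dder_mull; exact: d2.
rewrite /dA E; under [X in _ - X]eq_bigr do rewrite E.
apply: (dirac_square (H := fun s' s => pdA (pdA g s) s' p) vsq vac) => s s'.
exact: (pder_comm oD g2 Dp (coord_dir_ea _) (coord_dir_ea _)).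
Qed.

Lemma is_stemP D (F : {set 'I_tau} -> Pt -> A) : is_stem D F <->
  forall K (h : 'I_tau) p, D p -> F K (p.1, bflip h p.2) = (-1) ^+ (h \in K) *: F K p.
Proof.
have E (b : bool) (x : A) : (-1) ^+ b *: x = if b then - x else x.
  by case: b; rewrite ?scaleN1r ?scale1r.
by split=> H K h p Dp; rewrite H// E.
Qed.

Lemma bflip_line (h : 'I_tau) (b e : 'rV[R]_tau) (s k : R) : bflip h e = k *: e ->
  bflip h (b + s *: e) = bflip h b + s *: (k *: e).
Proof.
move=> <-; apply/rowP => j; rewrite !mxE.
by case: eqP => // _; rewrite opprD mulrN.
Qed.

Section Parity.
Variables (D : set Pt) (h : 'I_tau) (c : R) (g : Pt -> A).
Hypotheses (oD : open D) (gC1 : C1 D g)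
  (gpar : forall p, D p -> g (p.1, bflip h p.2) = c *: g p).

(** The flip sends the direction [e] to [k *: e], so by the chain rule differentiation along [e]
    multiplies the parity factor [c] by [k]. For alpha directions [k] is [1]; for [beta_h'] it is
    [-1] exactly when [h'] is the flipped index. *)
Lemma pder_parity p e (k : R) : D p -> k * k = 1 ->
  coord_dir e -> (e.1, bflip h e.2) = (e.1, k *: e.2) -> e.1 = k *: e.1 ->
  pder g e (p.1, bflip h p.2) = (k * c) *: pder g e p.
Proof.
move=> Dp kk ce [e2] e1; apply: has_dder_pder.
(* As [k * k = 1], the direction [e] is [k] times [k *: e], and the latter is the direction that
   equivariance handles. *)
rewrite -[e in has_dder _ _ e]scale1r -kk -!scalerA; apply: has_dder_scale_dir.
apply: (@has_dder_equivariant _ _ _ (fun q : Pt => (q.1, bflip h q.2))).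
- move=> s; rewrite /= (bflip_line _ _ e2).
  by apply/pair_equal_spec; split => //=; rewrite -e1.
- by apply: filterS (near_open_line e oD Dp) => s; apply: gpar.
- exact: (C1_has_dder gC1 Dp ce).
Qed.

Lemma pdA_parity s p : D p -> pdA g s (p.1, bflip h p.2) = c *: pdA g s p.
Proof.
move=> Dp; rewrite -[c]mul1r; apply: (pder_parity Dp (mul1r 1)).
- exact: coord_dir_ea.
- by congr (_, _); apply/rowP => j; rewrite !mxE/= mulr0; case: ifP; rewrite ?oppr0.
- by rewrite scale1r.
Qed.

Lemma pdB_parity h' p : D p ->
  pdB g h' (p.1, bflip h p.2) = ((-1) ^+ (h' == h) * c) *: pdB g h' p.
Proof.
move=> Dp; apply: pder_parity => //.
- by rewrite -expr2 sqrr_sign.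
- exact: coord_dir_eb.
- congr (_, _); apply/rowP => j; rewrite !mxE/=.
  have [->|_] := eqVneq j h'; last by rewrite mulr0 oppr0 if_same.
  by case: eqVneq; rewrite ?mulN1r ?mul1r.
- by rewrite scaler0.
Qed.

End Parity.

End StemCalculus.

(** * Multiplication of the ordered products [JK] by anticommuting elements *)

Section Products.
Context {R : realType} {A : falgType R}.

Lemma anticomm_prod (I : eqType) (r : seq I) (P : pred I) (x : A) (G : I -> A) :
  {in r, forall k, x * G k = - (G k * x)} ->
  x * \prod_(k <- r | P k) G k = (-1) ^+ count P r *: (\prod_(k <- r | P k) G k * x).
Proof.
elim: r => [|k r IH] xG; first by rewrite big_nil mulr1 mul1r expr0 scale1r.
have {}IH := IH (fun k' k'r => xG k' (@mem_behead _ (k :: r) k' k'r)).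
rewrite big_cons /=; case: (P k) => //=.
rewrite mulrA (xG k) ?mem_head// mulNr -(mulrA (G k) x) IH add1n exprS mulN1r scaleNr.
by rewrite -scalerAr mulrA.
Qed.

Lemma anticomm_sum (I : Type) (r : seq I) (P : pred I) (x : A) (G : I -> A) :
  (forall k, P k -> x * G k = - (G k * x)) ->
  x * \sum_(k <- r | P k) G k = - ((\sum_(k <- r | P k) G k) * x).
Proof.
by move=> xG; rewrite mulr_sumr mulr_suml -sumrN; apply: eq_bigr.
Qed.

Context {tau : nat}.
Implicit Types (J : 'I_tau -> A) (K : {set 'I_tau}) (h : 'I_tau).

Lemma anticomm_JK J K (x : A) : (forall k, x * J k = - (J k * x)) ->
  x * JK J K = (-1) ^+ #|K| *: (JK J K * x).
Proof.
move=> xJ; rewrite /JK anticomm_prod; last by move=> k _.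
by rewrite -sum1_card -sum1_count.
Qed.

Lemma in_symd K h k : (k \in symd K h) = (k \in K) (+) (k == h).
Proof. by rewrite !inE; case: (k \in K); case: (k == h). Qed.

Lemma symdK h : involutive (fun K => symd K h).
Proof. by move=> K; apply/setP => k; rewrite !in_symd -addbA addbb addbF. Qed.

Lemma index_enum_split h : exists s1 s2, [/\ index_enum 'I_tau = s1 ++ h :: s2,
  {in s1, forall k : 'I_tau, (k < h)%N} & {in s2, forall k : 'I_tau, (h < k)%N}].
Proof.
have hs : h \in index_enum 'I_tau by rewrite mem_index_enum.
have : sorted ltn (map val (index_enum 'I_tau)).
  by rewrite /index_enum -enumT val_enum_ord iota_ltn_sorted.
have [s1 s2] := splitPr hs => so; exists s1, s2.
move: so; rewrite map_cat sorted_pairwise; last exact: ltn_trans.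
rewrite pairwise_cat /= allrel_consr => /and3P[/andP[/allP h1 _] _ /andP[/allP h2 _]].
by split=> // k ks; [apply: h1|apply: h2]; exact: map_f.
Qed.

(** [J h] moves past the factors with index below [h], one sign each, and is then inserted, or meets
    another [J h] and yields [-1]. The two cases share one formula because [sgnT h (symd K h)]
    counts [h] itself exactly when [h] is inserted. *)
Lemma mulr_JK J K h :
  J h * J h = -1 -> (forall k, k != h -> J h * J k = - (J k * J h)) ->
  J h * JK J K = ((-1) * sgnT h (symd K h)) *: JK J (symd K h).
Proof.
move=> Jsq Jac; have [s1 [s2 [E lt1 lt2]]] := index_enum_split h.
have ne1 k : k \in s1 -> (k == h) = false by move=> /lt1; rewrite ltn_neqAle => /andP[/negbTE].
have ne2 k : k \in s2 -> (k == h) = false by move=> /lt2; rewrite ltn_neqAle eq_sym => /andP[/negbTE].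
have eqs (s : seq 'I_tau) : (forall k, k \in s -> (k == h) = false) ->
    \prod_(k <- s | k \in symd K h) J k = \prod_(k <- s | k \in K) J k.
  move=> sne; rewrite [LHS]big_seq_cond [RHS]big_seq_cond; apply: eq_bigl => k.
  by case ks: (k \in s) => //=; rewrite in_symd sne// addbF.
(* Toggling [h] leaves the indices below [h] alone and contributes one more element precisely when
   [h] was absent from [K]. *)
have cnt : #|[set k in symd K h | (k <= h)%N]| = (count (mem K) s1 + (h \notin K))%N.
  rewrite -sum1_card E big_cat big_cons /= inE in_symd leqnn eqxx andbT addbT.
  rewrite [X in (_ + X)%N](_ : _ = (h \notin K) :> nat); last first.
    rewrite big1_seq => [|k /andP[]]; first by case: (h \in K).
    by rewrite inE => /andP[_ +] /lt2; rewrite ltnNge => ->.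
  congr (_ + _)%N; rewrite -sum1_count [LHS]big_seq_cond [RHS]big_seq_cond.
  apply: eq_bigl => k; case ks: (k \in s1) => //=.
  by rewrite inE in_symd ne1// addbF ltnW ?andbT// lt1.
rewrite /JK /sgnT cnt !E !big_cat !big_cons /= eqs// eqs// in_symd eqxx addbT.
rewrite mulrA anticomm_prod; last by move=> k ks; apply: Jac; rewrite ne1.
rewrite signr_odd exprD -scalerAl -mulrA.
case: (h \in K) => /=; rewrite ?expr0 ?expr1.
  by rewrite mulr1 mulN1r [J h * (J h * _)]mulrA Jsq mulN1r mulrN scalerN scaleNr.
by rewrite mulrN1 mulN1r opprK.
Qed.

(** The parameter [c] treats both first-order operators at once: [1] gives the conjugate operator
    [dbarT] and [-1] gives [dT]. [Fa] and [Fb] stand for the alpha and beta partial derivatives. *)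
Lemma slice_dirac_identity n (v : nat -> A) J (c : R)
    (Fa : {set 'I_tau} -> 'I_n.+1 -> A) (Fb : {set 'I_tau} -> 'I_tau -> A) :
  (forall h, J h * J h = -1) ->
  (forall h k, h != k -> J h * J k = - (J k * J h)) ->
  (forall (s : nat) h, (0 < s <= n)%N -> v s * J h = - (J h * v s)) ->
  \sum_K JK J K * (Fa K ord0 +
     (c * (-1) ^+ #|K|) *: (\sum_(s < n.+1 | (0 < s)%N) v s * Fa K s) +
     \sum_(h < tau) (- c * sgnT h K) *: Fb (symd K h) h) =
  \sum_K JK J K * Fa K ord0 +
    c *: (\sum_(s < n.+1 | (0 < s)%N) v s * \sum_K JK J K * Fa K s) +
    c *: (\sum_(h < tau) J h * \sum_K JK J K * Fb K h).
Proof.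
move=> Jsq Jac vJ.
under eq_bigr do rewrite 2!mulrDr.
rewrite 2!big_split /=; congr (_ + _ + _).
- rewrite scaler_sumr; under [RHS]eq_bigr do rewrite mulr_sumr scaler_sumr.
  rewrite [RHS]exchange_big /=; apply: eq_bigr => K _.
  rewrite -scalerAr mulr_sumr scaler_sumr; apply: eq_bigr => s s0.
  rewrite [v s * (_ * _)]mulrA anticomm_JK; last first.
    by move=> k; apply: vJ; rewrite s0 -ltnS ltn_ord.
  by rewrite -scalerAl scalerA mulrA.
- rewrite scaler_sumr; under eq_bigr do rewrite mulr_sumr.
  rewrite exchange_big /=; apply: eq_bigr => h _.
  (* For fixed [h], summing over [symd K h] instead of [K] turns [Fb (symd K h) h] into [Fb K h] and
     produces exactly the sign of [mulr_JK]. *)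
  rewrite mulr_sumr scaler_sumr (reindex_inj (inv_inj (symdK h))) /=.
  apply: eq_bigr => K _; rewrite symdK mulrA mulr_JK//; last first.
    by move=> k kh; apply: Jac; rewrite eq_sym.
  by rewrite -scalerAr -scalerAl scalerA mulN1r mulrN mulNr.
Qed.

End Products.

(** * Multiplication and coordinates of torus elements *)

Section Torus.
Context {R : realType} {A : falgType R}.
Variables (N : nat) (v : nat -> A) (tau : nat) (t : nat -> nat).
Hypotheses
  (vsq : forall s : nat, (1 <= s <= N)%N -> v s * v s = -1)
  (vac : forall s s' : nat, (1 <= s <= N)%N -> (1 <= s' <= N)%N -> s != s' ->
     v s * v s' = - (v s' * v s))
  (vfree : forall c : nat -> R, \sum_(s < N.+1) c s *: v s = 0 ->
     forall s : nat, (s <= N)%N -> c s = 0)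
  (tlt : forall i : nat, (i < tau)%N -> (t i < t i.+1)%N)
  (ttau : t tau = N).

Implicit Types (J : 'I_tau -> A) (h k : 'I_tau).

Lemma t_mono i j : (i <= j <= tau)%N -> (t i <= t j)%N.
Proof.
elim: j => [|j IH] /andP[]; first by rewrite leqn0 => /eqP ->.
rewrite leq_eqVlt => /predU1P[->//|]; rewrite ltnS => ij jt.
by rewrite (leq_trans (IH _))// ?ij ?(ltnW jt)// ltnW// tlt.
Qed.

Lemma t_leN i : (i <= tau)%N -> (t i <= N)%N.
Proof. by move=> it; rewrite -ttau t_mono// it leqnn. Qed.

(** The indices [s] for which [v s] may occur in [J h]. Blocks lie above [t 0] and are pairwise
    disjoint, which yields the anticommutation relations below. *)
Definition block (h : 'I_tau) (s : nat) := (t h < s <= t h.+1)%N.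

Lemma block_bounds h s : block h s -> (t 0 < s <= N)%N.
Proof.
move=> /andP[lo up]; apply/andP; split.
  by apply: leq_ltn_trans lo; apply: t_mono; rewrite leq0n ltnW.
by apply: leq_trans up _; apply: t_leN.
Qed.

Lemma block_inj h k s : block h s -> block k s -> h = k.
Proof.
wlog hk : h k / (h <= k)%N => [W hs ks|/andP[_ up] /andP[lo _]].
  by case: (leqP h k) => [hk|/ltnW kh]; [|apply: esym]; apply: W.
apply/val_inj/eqP => /=; rewrite eqn_leq hk /= leqNgt; apply/negP => lt.
have := leq_trans lo up; rewrite ltnNge => /negP; apply.
by apply: t_mono; rewrite lt ltnW.
Qed.

Lemma sum_block (h : 'I_tau) (G : nat -> A) :
  \sum_((t h).+1 <= s < (t h.+1).+1) G s = \sum_(s < N.+1 | block h s) G s.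
Proof.
rewrite (big_nat_widen _ _ N.+1) ?ltnS ?t_leN// big_geq_mkord.
by apply: eq_bigl => s; rewrite /block ltnS andbC.
Qed.

Lemma in_torusP (J : 'I_tau -> A) : in_torus v t J -> exists c : 'I_tau -> nat -> R,
  forall h, J h = \sum_(s < N.+1 | block h s) c h s *: v s /\
            \sum_((t h).+1 <= s < (t h.+1).+1) c h s ^+ 2 = 1.
Proof.
move=> /choice[c cP]; exists c => h; have [-> ->] := cP h.
by rewrite sum_block.
Qed.

Lemma torus_anticomm_v J (s : nat) h : in_torus v t J -> (0 < s <= t 0)%N ->
  v s * J h = - (J h * v s).
Proof.
move=> /in_torusP[c /(_ h)[-> _]] /andP[s0 st]; apply: anticomm_sum => k kb.
have /andP[tk kN] := block_bounds kb.
rewrite -scalerAr -scalerAl -scalerN vac//.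
- by rewrite s0 (leq_trans st)// t_leN.
- by rewrite kN (leq_ltn_trans _ tk).
- by rewrite neq_ltn (leq_ltn_trans st tk).
Qed.

Lemma torus_anticomm J h k : in_torus v t J -> h != k ->
  J h * J k = - (J k * J h).
Proof.
move=> /in_torusP[c cJ] hk; have [-> _] := cJ k; have [-> _] := cJ h.
apply: anticomm_sum => i ik; apply: oppr_inj; rewrite opprK; apply: esym.
apply: anticomm_sum => j jh.
have /andP[ti iN] := block_bounds ik; have /andP[tj jN] := block_bounds jh.
rewrite -scalerAr -scalerAl -scalerAr -scalerAl vac.
- by rewrite !scalerN !scalerA [c k i * _]mulrC.
- by rewrite iN (leq_ltn_trans _ ti).
- by rewrite jN (leq_ltn_trans _ tj).
- by apply/eqP => ij; move/eqP: hk; apply; apply: block_inj jh _; rewrite -ij.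
Qed.

(** Squaring a combination of anticommuting units leaves only the diagonal, which is minus the
    squared norm of the coefficients, that is [-1]. *)
Lemma torus_sqr J h : in_torus v t J -> J h * J h = -1.
Proof.
move=> /in_torusP[c /(_ h)[-> cs]].
have := @anticommuting_symmetric_sum _ _ 'I_N.+1 (block h \o val) (fun s => v s)
  (fun i j => (c h i * c h j)%:A).
have bb i : block h i -> (1 <= i <= N)%N.
  by move=> /block_bounds/andP[ti ->]; rewrite (leq_ltn_trans _ ti).
move=> H; rewrite mulr_suml; apply: etrans (etrans (H _ _ _) _).
- apply: eq_bigr => i _; rewrite -scalerAl !mulr_sumr scaler_sumr.
  by apply: eq_bigr => j _; rewrite -!scalerAr mulr1 !scalerA.
- by move=> i /bb; apply: vsq.
- by move=> i j /bb ib /bb jb ij; apply: vac.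
- by move=> i j _ _; rewrite mulrC.
- rewrite -scaler_suml; congr (- _).
  rewrite -[RHS]scale1r -cs; congr (_ *: _).
  rewrite (big_nat_widen _ _ N.+1) ?ltnS ?t_leN// big_geq_mkord.
  by apply: eq_big => s; rewrite /= ?/block ?ltnS 1?andbC// => _; rewrite expr2.
Qed.

(** Both presentations are expanded in the independent [v s] and compared coefficient by
    coefficient. On each block this makes [b h *: J h] and [p.2 0 h *: J' h] equal, and comparing
    norms gives the squares. *)
Lemma torus_coordinates J J' (p : 'rV[R]_(t 0%N).+1 * 'rV[R]_tau)
    (a : nat -> R) (b : 'I_tau -> R) :
  in_torus v t J -> in_torus v t J' ->
  tpt v p J' = \sum_(s < (t 0%N).+1) a s *: v s + \sum_(h < tau) b h *: J h ->
  (forall s : 'I_(t 0%N).+1, p.1 0 s = a s) /\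
  (forall h, b h *: J h = p.2 0 h *: J' h /\ b h ^+ 2 = p.2 0 h ^+ 2).
Proof.
move=> /in_torusP[c cJ] /in_torusP[c' cJ'] E.
(* The coefficient of [v s] in the sum of the [d h *: G h], where [e h] lists the coefficients of
   [G h]; at most one summand is nonzero since blocks are disjoint. *)
pose bl (d : 'I_tau -> R) (e : 'I_tau -> nat -> R) (s : nat) : R :=
  \sum_h (if block h s then d h * e h s else 0).
have blE (d : 'I_tau -> R) (e : 'I_tau -> nat -> R) (G : 'I_tau -> A) :
    (forall h, G h = \sum_(s < N.+1 | block h s) e h s *: v s) ->
    \sum_h d h *: G h = \sum_(s < N.+1) bl d e s *: v s.
  move=> GE; under [RHS]eq_bigr do rewrite scaler_suml.
  rewrite [RHS]exchange_big /=; apply: eq_bigr => h _.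
  rewrite GE scaler_sumr big_mkcond; apply: eq_bigr => s _.
  by case: ifP => _; rewrite ?scale0r ?scalerA.
pose al (x : nat -> R) (s : nat) : R := if (s <= t 0)%N then x s else 0.
have alE (x : nat -> R) : \sum_(s < (t 0%N).+1) x s *: v s = \sum_(s < N.+1) al x s *: v s.
  rewrite (big_ord_widen N.+1 (fun s => x s *: v s)) ?ltnS ?t_leN//.
  rewrite big_mkcond; apply: eq_bigr => s _; rewrite /al ltnS.
  by case: ifP => _; rewrite ?scale0r.
(* The default value of [inord] beyond [t 0] is harmless, as [al] cuts those indices off. *)
pose x0 (s : nat) := p.1 0 (inord s).
have F s : (s <= N)%N -> al x0 s + bl (p.2 0) c' s - (al a s + bl b c s) = 0.
  move=> sN; apply: (vfree (c := fun s => al x0 s + bl (p.2 0) c' s - (al a s + bl b c s))) => //.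
  under eq_bigr do rewrite scalerBl !scalerDl.
  rewrite sumrB !big_split/= -!alE.
  rewrite -(blE _ _ _ (fun h => (cJ h).1)) -(blE _ _ _ (fun h => (cJ' h).1)).
  rewrite -E /tpt /alpha_of; apply/eqP; rewrite subr_eq0; apply/eqP.
  by congr (_ + _); apply: eq_bigr => i _; rewrite /x0 inord_val.
have block_bl d e h s : block h s -> bl d e s = d h * e h s.
  move=> hs; rewrite /bl (bigD1 h)//= hs big1 ?addr0// => k kh.
  by case: ifP => // ks; rewrite (block_inj ks hs) eqxx in kh.
split=> [s|h].
  have st : (s <= t 0)%N by rewrite -ltnS.
  have := F s (leq_trans st (t_leN (leq0n _))); rewrite /al st.
  have bl0 d e : bl d e s = 0.
    by apply: big1 => h _; case: ifP => // /block_bounds; rewrite ltnNge st.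
  by rewrite !bl0 !addr0 /x0 inord_val => /eqP; rewrite subr_eq0 => /eqP.
have co s : block h s -> b h * c h s = p.2 0 h * c' h s.
  move=> hs; have /andP[ts sN] := block_bounds hs.
  have := F s sN; rewrite /al leqNgt ts/= !add0r !(block_bl _ _ _ _ hs).
  by move=> /eqP; rewrite subr_eq0 => /eqP.
have [-> c1] := cJ h; have [-> c1'] := cJ' h; split.
  by rewrite !scaler_sumr; apply: eq_bigr => s hs; rewrite !scalerA co.
(* Each factor [1] is replaced by the squared norm of the coefficients of [J h] or [J' h], so the
   squares agree term by term through [co]. *)
rewrite -[LHS]mulr1 -[RHS]mulr1 -{1}c1 -c1' !mulr_sumr.
by apply: eq_big_nat => s hs; rewrite -!exprMn co.
Qed.

End Torus.

(** * Sign flips and independence of the presentation *)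

Section Flips.
Context {R : realType} {A : falgType R} {t : nat -> nat} {tau : nat}.
Local Notation Pt := ('rV[R]_(t 0%N).+1 * 'rV[R]_tau)%type.
Variable (D : set Pt).
Hypothesis Dflip : forall (h : 'I_tau) p, D p -> D (p.1, bflip h p.2).

(** Only membership in [S] decides a sign, so this agrees with iterating [bflip] along lists without
    repetition. *)
Definition flips (S : seq 'I_tau) (b : 'rV[R]_tau) : 'rV[R]_tau :=
  \row_j ((-1) ^+ (j \in S) * b 0 j).

Lemma flips_cons h S b : h \notin S -> flips (h :: S) b = bflip h (flips S b).
Proof.
move=> hS; apply/rowP => j; rewrite !mxE in_cons.
by have [->|] := eqVneq j h; rewrite /= ?(negbTE hS) ?mulN1r ?mul1r.
Qed.

Lemma flips_nil b : flips [::] b = b.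
Proof. by apply/rowP => j; rewrite !mxE mul1r. Qed.

Lemma flips_stable S p : uniq S -> D p -> D (p.1, flips S p.2).
Proof.
elim: S => [|h S IH] /=; first by rewrite flips_nil; case: p.
by move=> /andP[hS uS] Dp; rewrite flips_cons//; apply: (Dflip h (IH uS Dp)).
Qed.

Lemma stem_flips (F : {set 'I_tau} -> Pt -> A) K S p : is_stem D F -> uniq S -> D p ->
  F K (p.1, flips S p.2) = (\prod_(k < tau | k \in K) (-1) ^+ (k \in S)) *: F K p.
Proof.
move=> /is_stemP stF; elim: S => [|h S IH] /=.
  by rewrite flips_nil big1 ?scale1r//; case: p.
move=> /andP[hS uS] Dp; rewrite flips_cons//.
rewrite (stF _ _ (p.1, flips S p.2)) ?IH//; last exact: flips_stable.
rewrite scalerA; congr (_ *: _).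
(* The sign of the new flip is written as a product over [K] so that it merges factor by factor with
   the inductive one. *)
have -> : (-1) ^+ (h \in K) = \prod_(k < tau | k \in K) (-1) ^+ (k == h) :> R.
  case: (boolP (h \in K)) => hK.
    rewrite (bigD1 h)//= eqxx big1 ?mulr1// => k /andP[_ /negbTE ->//].
  by rewrite big1// => k kK; case: eqP => // kh; rewrite -kh kK in hK.
rewrite -big_split/=; apply: eq_bigr => k _; rewrite in_cons.
by have [->|_] := eqVneq k h; rewrite ?(negbTE hS) ?mulr1 ?mul1r.
Qed.

(** The flip of [k] fixes [p], so oddness makes the value its own opposite. *)
Lemma stem_eq0 (F : {set 'I_tau} -> Pt -> A) (K : {set 'I_tau}) k p :
  is_stem D F -> D p -> k \in K -> p.2 0 k = 0 -> F K p = 0.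
Proof.
move=> stF Dp kK pk; have := stF K k p Dp; rewrite kK.
have -> : bflip k p.2 = p.2.
  by apply/rowP => j; rewrite mxE; case: eqP => // ->; rewrite pk oppr0.
move=> E; apply/eqP; have : 2%:R *: F K p == 0.
  by rewrite scaler_nat mulr2n addr_eq0 -E -surjective_pairing.
by rewrite scaler_eq0 pnatr_eq0.
Qed.

(* The representation [alpha + beta J] of a point is unique up to flips, except
   that [J h] is arbitrary when [beta h = 0]; there the odd components vanish. *)
Lemma stemI_flips (F : {set 'I_tau} -> Pt -> A) S p (J J' : 'I_tau -> A) :
  is_stem D F -> uniq S -> D p ->
  (forall h, ((-1) ^+ (h \in S) * p.2 0 h) *: J h = p.2 0 h *: J' h) ->
  stemI F (p.1, flips S p.2) J = stemI F p J'.
Proof.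
move=> stF uS Dp JJ'; apply: eq_bigr => K _; rewrite stem_flips//.
case: (pselect (exists2 k, k \in K & p.2 0 k = 0)) => [[k kK pk]|nz].
  by rewrite (stem_eq0 stF Dp kK pk) scaler0 !mulr0.
rewrite -scalerAr scalerAl /JK -scaler_prod; congr (_ * _).
apply: eq_bigr => k kK; apply: (@scalerI _ _ (p.2 0 k)).
  by apply/eqP => pk; apply: nz; exists k.
by rewrite scalerA mulrC.
Qed.

End Flips.

(** * Derivatives along a slice, and stem property of the transformed functions *)

Section Slices.
Context {R : realType} {A : falgType R} {t : nat -> nat} {tau : nat}.
Local Notation Pt := ('rV[R]_(t 0%N).+1 * 'rV[R]_tau)%type.
Variables (D : set Pt) (F : {set 'I_tau} -> Pt -> A) (v : nat -> A).
Hypotheses (oD : open D) (FC1 : forall K, C1 D (F K)).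

Lemma tpt_ea (p : Pt) s (r : R) (J : 'I_tau -> A) :
  tpt v (p + r *: ea tau s) J = tpt v p J + r *: v s.
Proof.
rewrite /tpt /alpha_of /= scaler0 addr0 addrAC; congr (_ + _).
under eq_bigr do rewrite !mxE scalerDl.
rewrite big_split/=; congr (_ + _); rewrite (bigD1 s)//= big1 ?addr0.
  by rewrite eqxx mulr1.
by move=> i /negbTE ->; rewrite mulr0 scale0r.
Qed.

Lemma tpt_eb (p : Pt) h (r : R) (J : 'I_tau -> A) :
  tpt v (p + r *: eb t h) J = tpt v p J + r *: J h.
Proof.
rewrite /tpt /alpha_of /= scaler0 addr0 -addrA; congr (_ + _).
under eq_bigr do rewrite !mxE scalerDl.
rewrite big_split/=; congr (_ + _); rewrite (bigD1 h)//= big1 ?addr0.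
  by rewrite eqxx mulr1.
by move=> i /negbTE ->; rewrite mulr0 scale0r.
Qed.

(** For fixed [J] the induced function has constant left coefficients [JK J K], and short segments
    from [q] stay in the open set [D], where [f] is prescribed. Only values on the slice of [J] are
    required, so the result can be iterated for second derivatives. *)
Lemma dirder_slice (f : A -> A) (J : 'I_tau -> A) (e : Pt) (w : A) (q : Pt) :
  (forall p, D p -> f (tpt v p J) = stemI F p J) -> coord_dir e ->
  (forall (p : Pt) (r : R), tpt v (p + r *: e) J = tpt v p J + r *: w) ->
  D q -> dirder f (tpt v q J) w = stemI (fun K => pder (F K) e) q J.
Proof.
move=> fF ce tE Dq; apply: has_dder_dirder.
have : has_dder (fun p => stemI F p J) q e (stemI (fun K => pder (F K) e) q J).
  apply: has_dder_sum => K _; apply: has_dder_mull.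
  exact: (C1_has_dder (FC1 K) Dq ce).
move=> /has_dder_lineP; apply: has_dder_near.
by apply: filterS (near_open_line e oD Dq) => r Dr; rewrite -tE fF.
Qed.

Hypotheses (Fst : is_stem D F).

Let Fpar K h p : D p -> F K (p.1, bflip h p.2) = (-1) ^+ (h \in K) *: F K p.
Proof. by move=> Dp; apply: ((is_stemP D F).1 Fst). Qed.

Lemma dbarU_parity u K h p : D p ->
  dbarU v u (F K) (p.1, bflip h p.2) = (-1) ^+ (h \in K) *: dbarU v u (F K) p.
Proof.
move=> Dp; have E s := pdA_parity oD (FC1 K) (Fpar K h) s Dp.
rewrite /dbarU E scalerBr; congr (_ - _).
rewrite scalerA mulrC -scalerA; congr (_ *: _); rewrite scaler_sumr.
by apply: eq_bigr => s _; rewrite E scalerAr.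
Qed.

(** Toggling [h'] in [K] and differentiating in [beta_h'] each change the parity in [h] exactly when
    [h = h'], so the changes cancel. *)
Lemma pdB_symd_parity K h h' p : D p ->
  pdB (F (symd K h')) h' (p.1, bflip h p.2) =
  (-1) ^+ (h \in K) *: pdB (F (symd K h')) h' p.
Proof.
move=> Dp; rewrite (pdB_parity oD (FC1 _) (Fpar _ h) h' Dp); congr (_ *: _).
rewrite in_symd [h' == h]eq_sym.
by case: (h \in K); case: (h == h'); rewrite /= ?mulrNN ?mulr1 ?mul1r.
Qed.

Lemma dbarT_stem : is_stem D (dbarT v F).
Proof.
apply/is_stemP => K h p Dp; rewrite /dbarT dbarU_parity// [RHS]scalerDr; congr (_ + _).
rewrite scaler_sumr; apply: eq_bigr => h' _.
by rewrite pdB_symd_parity// !scalerA mulrC.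
Qed.

Lemma dT_stem : is_stem D (dT v F).
Proof.
apply/is_stemP => K h p Dp; rewrite /dT dbarU_parity// [RHS]scalerDr; congr (_ + _).
rewrite scaler_sumr; apply: eq_bigr => h' _.
by rewrite pdB_symd_parity// !scalerA mulrC.
Qed.

(** The value of [LapT] on [D] once the mixed alpha derivatives have cancelled; in this form the
    parity of each term is immediate. *)
Definition scalarLap K p : A :=
  \sum_s pdA (pdA (F K) s) s p + \sum_h pdB (pdB (F K) h) h p.

Hypothesis FC2 : forall K, C2 D (F K).

Lemma scalarLap_stem : is_stem D scalarLap.
Proof.
apply/is_stemP => K h p Dp; rewrite /scalarLap scalerDr; congr (_ + _).
  rewrite scaler_sumr; apply: eq_bigr => s _.
  apply: (pdA_parity oD _ _ s Dp); first exact: ((FC2 K).2 _ (coord_dir_ea s)).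
  by move=> q; exact: (pdA_parity oD (FC1 K) (Fpar K h)).
rewrite scaler_sumr; apply: eq_bigr => h' _.
have par1 q (Dq : D q) := pdB_parity oD (FC1 K) (Fpar K h) h' Dq.
rewrite (pdB_parity oD ((FC2 K).2 _ (coord_dir_eb h')) par1 h' Dp).
by rewrite mulrA -expr2 sqrr_sign mul1r.
Qed.

Lemma LapT_scalarLap K p : D p ->
  (forall s : nat, (0 < s <= t 0)%N -> v s * v s = -1) ->
  (forall s s' : nat, (0 < s <= t 0)%N -> (0 < s' <= t 0)%N -> s != s' ->
     v s * v s' = - (v s' * v s)) ->
  LapT v F K p = scalarLap K p.
Proof. by move=> Dp vsq vac; rewrite /LapT (dA_dbarA oD (FC2 K) Dp vsq vac). Qed.

End Slices.

(** * Comparison of the global operators with the slice operators *)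

Lemma in_SA_sqr (R : realType) (A : falgType R) (cj : A -> A) (x : A) :
  in_SA cj x -> x * x = -1.
Proof.
move=> [/eqP]; rewrite addrC addr_eq0 => /eqP cx; rewrite cx mulrN => <-.
by rewrite opprK.
Qed.

Theorem theorem3p9
  (R : realType) (A : falgType R) (cj : A -> A)
  (N : nat) (v : nat -> A) (tau : nat) (t : nat -> nat)
  (D : set ('rV[R]_(t 0%N).+1 * 'rV[R]_tau))
  (F : {set 'I_tau} -> 'rV[R]_(t 0%N).+1 * 'rV[R]_tau -> A)
  (f : A -> A) (J : 'I_tau -> A) :
  (* A: finite-dimensional unital associative real algebra with *-involution *)
  star_involution cj ->
  (exists x : A, in_SA cj x) ->
  (* V with basis v_0 = 1, v_1, ..., v_N *)
  (1 <= N)%N ->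
  v 0%N = 1 ->
  (forall s : nat, (1 <= s <= N)%N -> in_SA cj (v s)) ->
  (forall s s' : nat, (1 <= s <= N)%N -> (1 <= s' <= N)%N -> s != s' ->
     v s * v s' = - (v s' * v s)) ->
  (forall c : nat -> R, \sum_(s < N.+1) c s *: v s = 0 ->
     forall s : nat, (s <= N)%N -> c s = 0) ->
  (forall x : A, in_span v 0 N x ->
     exists I : A, in_SA cj I /\ exists a b : R, x = a%:A + b *: I) ->
  (* T = (t_0, ..., t_tau), 0 <= t_0 < ... < t_tau = N *)
  (forall i : nat, (i < tau)%N -> (t i < t i.+1)%N) ->
  t tau = N ->
  (* D open, invariant under beta |-> \overline{beta}^h *)
  open D ->
  (forall (h : 'I_tau) p, D p -> D (p.1, bflip h p.2)) ->
  (* f = I(F) in S^1_T(Omega_D, A) *)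
  is_stem D F ->
  (forall K, C1 D (F K)) ->
  (forall p J', D p -> in_torus v t J' -> f (tpt v p J') = stemI F p J') ->
  (* J in the torus *)
  in_torus v t J ->
  ((forall p J', D p -> in_torus v t J' -> in_RJ v t J (tpt v p J') ->
      stemI (dbarT v F) p J' = dbarJ v t J f (tpt v p J')) /\
   (forall p J', D p -> in_torus v t J' -> in_RJ v t J (tpt v p J') ->
      stemI (dT v F) p J' = dJ v t J f (tpt v p J'))) /\
  ((forall K, C2 D (F K)) ->
   forall p J', D p -> in_torus v t J' -> in_RJ v t J (tpt v p J') ->
      stemI (LapT v F) p J' = LapJ v t J f (tpt v p J')).
Proof.
move=> _ _ N1 v0 vSA vac vfree _ tlt ttau oD Dflip Fst FC1 fF TJ.
have vsq s : (1 <= s <= N)%N -> v s * v s = -1 by move=> /vSA; apply: in_SA_sqr.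
have t0N : (t 0 <= N)%N := t_leN tlt ttau (leq0n tau).
have wide s : (0 < s <= t 0)%N -> (1 <= s <= N)%N.
  by move=> /andP[-> st]; apply: leq_trans st t0N.
have vsq0 s (st : (0 < s <= t 0)%N) := vsq s (wide s st).
have vac0 s s' (st : (0 < s <= t 0)%N) (st' : (0 < s' <= t 0)%N) :=
  vac s s' (wide s st) (wide s' st').
have Jsq h := torus_sqr vsq vac tlt ttau h TJ.
have Jac h k := torus_anticomm vac tlt ttau TJ (h := h) (k := k).
have vJ s h := torus_anticomm_v vac tlt ttau h TJ (s := s).
(* Any point of the slice is presented with [J] itself, at a parameter [q] that serves every stem
   function simultaneously. *)
have transfer p J' : D p -> in_torus v t J' -> in_RJ v t J (tpt v p J') ->
    exists q, [/\ D q, tpt v q J = tpt v p J' &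
      forall G, is_stem D G -> stemI G p J' = stemI G q J].
  move=> Dp TJ' [a [b E]].
  have [aE bE] := torus_coordinates vfree tlt ttau TJ TJ' E.
  (* Equal squares leave [b h] equal to [p.2 0 h] or to its opposite; [S] collects the indices where
     the sign really changes. *)
  pose S := [seq h <- enum 'I_tau | b h != p.2 0 h].
  have uS : uniq S by rewrite filter_uniq// enum_uniq.
  have bS h : (-1) ^+ (h \in S) * p.2 0 h = b h.
    rewrite mem_filter mem_enum andbT; have [->|ne] := eqVneq; first by rewrite mul1r.
    have /eqP := (bE h).2; rewrite eqf_sqr (negbTE ne) /= => /eqP ->.
    by rewrite mulN1r.
  exists (p.1, flips S p.2); split.
  - exact: (flips_stable Dflip uS Dp).
  - rewrite E /tpt /alpha_of; congr (_ + _); apply: eq_bigr => i _ /=.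
      by rewrite aE.
    by rewrite mxE bS.
  - move=> G stG; apply/esym/(stemI_flips Dflip stG uS Dp) => h.
    by rewrite bS (bE h).1.
have fFJ p (Dp : D p) : f (tpt v p J) = stemI F p J := fF p J Dp TJ.
have dirA q s (Dq : D q) := dirder_slice oD FC1 fFJ (coord_dir_ea s)
  (fun p r => tpt_ea v p s r J) Dq.
have dirB q h (Dq : D q) := dirder_slice oD FC1 fFJ (coord_dir_eb h)
  (fun p r => tpt_eb v p h r J) Dq.
split; first split.
- move=> p J' Dp TJ' RJ; have [q [Dq <- ->]] := transfer _ _ Dp TJ' RJ; last exact: (dbarT_stem v oD FC1 Fst).
  (* With [c = 1], the coefficient [(-1) ^+ #|K|] equals the [- (-1) ^+ #|K|.+1] of [dbarU]. *)
  have := slice_dirac_identity 1 (fun K s => pdA (F K) s q) (fun K h => pdB (F K) h q) Jsq Jac vJ.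
  rewrite !scale1r => H; apply: etrans (etrans _ H) _.
    apply: eq_bigr => K _; rewrite /dbarT /dbarU; congr (_ * (_ + _ + _)).
    by rewrite mul1r exprS mulN1r scaleNr opprK.
  rewrite /dbarJ [in RHS](bigD1 ord0)//= v0 mul1r.
  congr (_ + _ + _).
  - by rewrite -v0; apply/esym/(dirA _ ord0).
  - apply: eq_big => [s|s _]; first by rewrite lt0n.
    by congr (_ * _); apply/esym/dirA.
  - by apply: eq_bigr => h _; congr (_ * _); apply/esym/dirB.
- move=> p J' Dp TJ' RJ; have [q [Dq <- ->]] := transfer _ _ Dp TJ' RJ; last exact: (dT_stem v oD FC1 Fst).
  have := slice_dirac_identity (-1) (fun K s => pdA (F K) s q) (fun K h => pdB (F K) h q) Jsq Jac vJ.
  rewrite !scaleN1r => H; apply: etrans (etrans _ H) _.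
    apply: eq_bigr => K _; rewrite /dT /dbarU; congr (_ * (_ + _ + _)).
      by rewrite mulN1r scaleNr.
    by apply: eq_bigr => h _; rewrite opprK mul1r.
  rewrite /dJ; congr (_ - _ - _).
  - by apply/esym/(dirA _ ord0).
  - by apply: eq_bigr => s _; congr (_ * _); apply/esym/dirA.
  - by apply: eq_bigr => h _; congr (_ * _); apply/esym/dirB.
move=> FC2 p J' Dp TJ' RJ.
(* [LapT F] is replaced by [scalarLap F] before changing the presentation, since the stem property
   is available for the latter. *)
have lapE q J0 : D q -> stemI (LapT v F) q J0 = stemI (scalarLap F) q J0.
  by move=> Dq; apply: eq_bigr => K _; rewrite (LapT_scalarLap oD FC2 K Dq vsq0 vac0).
rewrite lapE//; have [q [Dq <- ->]] := transfer _ _ Dp TJ' RJ; last exact: (scalarLap_stem oD FC1 Fst FC2).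
(* By [dirA] the first derivative of [f] along [v s] is induced on the slice by the partial
   derivatives of the [F K], which are again [C1], so the slice formula applies a second time. *)
have dirAA s := dirder_slice (f := fun z => dirder f z (v s)) oD
  (fun K => (FC2 K).2 _ (coord_dir_ea s))
  (fun p Dp => dirA p s Dp) (coord_dir_ea s) (fun p r => tpt_ea v p s r J) Dq.
have dirBB h := dirder_slice (f := fun z => dirder f z (J h)) oD
  (fun K => (FC2 K).2 _ (coord_dir_eb h))
  (fun p Dp => dirB p h Dp) (coord_dir_eb h) (fun p r => tpt_eb v p h r J) Dq.
rewrite /stemI /scalarLap; under eq_bigr do rewrite mulrDr !mulr_sumr.
rewrite big_split/= exchange_big/= [X in _ + X]exchange_big/=.
congr (_ + _); apply: eq_bigr => i _; first exact/esym/dirAA.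
exact/esym/dirBB.
Qed.
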